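(* Let $\mathcal{H}$ be an infinite dimensional complex Hilbert space, let $m\ge 1$ be an integer, let $P\in B(\mathcal{H})$ be a positive invertible operator, and let $A,B\in B(\mathcal{H})$ be power bounded operators such that the pair $(A,B)$ preserves order. If $(A,B)$ is $(m,P)$-expansive, then there exist positive invertible operators $P_1,P_2\in B(\mathcal{H})$ and isometries $V_1,V_2\in B(\mathcal{H})$ such that $A=P_1^{-1}V_1^*P_1$ and $B=P_2^{-1}V_2P_2$.
   Context: $B(\mathcal{H})$ is the algebra of bounded linear operators on $\mathcal{H}$. For $A,B,P\in B(\mathcal{H})$ and an integer $m\ge 1$ put $\triangle_{A,B}^m(P)=\sum_{j=0}^m(-1)^j\binom{m}{j}A^jPB^j$. The pair $(A,B)$ is $(m,P)$-expansive if $\triangle_{A,B}^m(P)\le 0$. The pair $(A,B)$ preserves order if $AXB\ge 0$ for every $X\in B(\mathcal{H})$ with $X\geq 0$. An operator $T$ is power bounded if there is $M>0$ with $\sup_{n}\|T^n\|\le M$. *)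

(* Defs.v *)
From HB Require Import structures.
From mathcomp Require Import all_boot all_order all_algebra.
From mathcomp Require Import complex.
From mathcomp Require Import all_classical all_reals all_analysis.

Set Implicit Arguments.
Unset Strict Implicit.
Unset Printing Implicit Defensive.

Import Order.TTheory GRing.Theory Num.Theory.
Import numFieldNormedType.Exports.

Local Open Scope classical_set_scope.
Local Open Scope ring_scope.

(* The inner product is linear in its first argument, and on R[i] the relation
   0 <= z means that z is real and nonnegative. *)
HB.mixin Record CompleteNormedModule_isHilbert (R : realType) H
    of CompleteNormedModule R[i] H := {
  inner : {dot H for @Num.conj R[i]} ;
  sqr_norm_inner : forall x : H, `|x| ^+ 2 = inner x x
}.

#[short(type="hilbertType")]
HB.structure Definition Hilbert (R : realType) :=
  {H of CompleteNormedModule R[i] H & CompleteNormedModule_isHilbert R H}.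

Definition infinite_dimensional (K : fieldType) (V : lmodType K) : Prop :=
  forall (n : nat) (v : 'I_n -> V),
    exists x : V, forall a : 'I_n -> K, x <> \sum_(i < n) a i *: v i.

Section BoundedOperators.
Context {R : realType} {H : hilbertType R}.
Implicit Types f g : H -> H.

Definition bounded_linear_op f : Prop :=
  linear f /\ exists M : R[i], forall x : H, `|f x| <= M * `|x|.

Record bop : Type := Bop {
  bop_fun :> H -> H ;
  _ : `[< bounded_linear_op bop_fun >]
}.

HB.instance Definition _ := [isSub for bop_fun].
HB.instance Definition _ := [Choice of bop by <:].

Lemma bopP (T : bop) : bounded_linear_op T.
Proof. by case: T => f /= /asboolP. Qed.

Lemma bop_eqP (S T : bop) : (forall x, S x = T x) -> S = T.
Proof. by move=> ST; apply/val_inj/funext. Qed.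

HB.instance Definition _ (T : bop) :=
  GRing.isLinear.Build R[i] H H *:%R T (bopP T).1.

Lemma bop_bound (T : bop) :
  exists2 M : R[i], 0 <= M & forall x : H, `|T x| <= M * `|x|.
Proof.
have [_ [M TM]] := bopP T.
have [M0|M0] := boolP (0 <= M); first by exists M.
exists 0 => // x; have [->|x0] := eqVneq x 0; first by rewrite linear0 !normr0 mulr0.
case/negP: M0; rewrite -(pmulr_lge0 M (_ : 0 < `|x|)) ?normr_gt0//.
exact: le_trans (TM x).
Qed.

Fact bop_subproof f : bounded_linear_op f -> `[< bounded_linear_op f >].
Proof. by move/asboolP. Qed.

Fact bop0_subproof : bounded_linear_op (fun _ : H => 0 : H).
Proof.
split; first by move=> a x y; rewrite scaler0 addr0.
by exists 0 => x; rewrite normr0 mul0r.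
Qed.

Fact bop1_subproof : bounded_linear_op (fun x : H => x).
Proof. by split=> //; exists 1 => x; rewrite mul1r. Qed.

Fact bopN_subproof (T : bop) : bounded_linear_op (fun x => - T x).
Proof.
split; first by move=> a x y; rewrite linearP opprD scalerN.
by have [M _ TM] := bop_bound T; exists M => x; rewrite normrN.
Qed.

Fact bopD_subproof (S T : bop) : bounded_linear_op (fun x => S x + T x).
Proof.
split; first by move=> a x y; rewrite !linearP scalerDr addrACA.
have [[M _ SM] [N _ TN]] := (bop_bound S, bop_bound T).
exists (M + N) => x; rewrite mulrDl (le_trans (ler_normD _ _))//.
exact: lerD.
Qed.

Fact bopM_subproof (S T : bop) : bounded_linear_op (fun x => S (T x)).
Proof.
split; first by move=> a x y; rewrite !linearP.
have [[M M0 SM] [N _ TN]] := (bop_bound S, bop_bound T).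
by exists (M * N) => x; rewrite (le_trans (SM _))// -mulrA ler_wpM2l.
Qed.

Definition bop0 : bop := Bop (bop_subproof bop0_subproof).
Definition bop1 : bop := Bop (bop_subproof bop1_subproof).
Definition bopN (T : bop) : bop := Bop (bop_subproof (bopN_subproof T)).
Definition bopD (S T : bop) : bop := Bop (bop_subproof (bopD_subproof S T)).
Definition bopM (S T : bop) : bop := Bop (bop_subproof (bopM_subproof S T)).

Fact bopDA : associative bopD.
Proof. by move=> S T U; apply: bop_eqP => x /=; rewrite addrA. Qed.
Fact bopDC : commutative bopD.
Proof. by move=> S T; apply: bop_eqP => x /=; rewrite addrC. Qed.
Fact bop0D : left_id bop0 bopD.
Proof. by move=> T; apply: bop_eqP => x /=; rewrite add0r. Qed.
Fact bopND : left_inverse bop0 bopN bopD.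
Proof. by move=> T; apply: bop_eqP => x /=; rewrite addNr. Qed.

HB.instance Definition _ := GRing.isZmodule.Build bop bopDA bopDC bop0D bopND.

Fact bopMA : associative bopM.
Proof. by move=> S T U; apply: bop_eqP. Qed.
Fact bop1M : left_id bop1 bopM.
Proof. by move=> T; apply: bop_eqP. Qed.
Fact bopM1 : right_id bop1 bopM.
Proof. by move=> T; apply: bop_eqP. Qed.
Fact bopMDl : left_distributive bopM bopD.
Proof. by move=> S T U; apply: bop_eqP. Qed.
Fact bopMDr : right_distributive bopM bopD.
Proof. by move=> S T U; apply: bop_eqP => x /=; rewrite linearD. Qed.

HB.instance Definition _ :=
  GRing.Zmodule_isPzRing.Build bop bopMA bop1M bopM1 bopMDl bopMDr.

End BoundedOperators.

Arguments bop {R} H.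
Notation "''B' ( H )" := (bop H) (at level 8, format "''B' ( H )") : type_scope.

Section OperatorNotions.
Context {R : realType} {H : hilbertType R}.
Implicit Types (A B P S T V X : 'B(H)).

Definition opnorm T : R :=
  sup [set complex.Re `|T x| | x in [set x : H | `|x| <= 1]].

Definition power_bounded T : Prop :=
  exists2 M : R, 0 < M & forall n : nat, opnorm (T ^+ n) <= M.

(* On a complex space this forces T to be self-adjoint. *)
Definition opge0 T : Prop := forall x : H, 0 <= inner (T x) x.

Definition ople S T : Prop := opge0 (T - S).

Definition is_adjoint T S : Prop :=
  forall x y : H, inner (T x) y = inner x (S y).

Definition is_inverse T S : Prop := T * S = 1 /\ S * T = 1.

Definition invertible T : Prop := exists S, is_inverse T S.

Definition isometric V : Prop := forall x : H, `|V x| = `|x|.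

Definition triangle A B (m : nat) P : 'B(H) :=
  \sum_(j < m.+1) (-1) ^+ j * (A ^+ j * P * B ^+ j) *+ 'C(m, j).

Definition expansive A B (m : nat) P : Prop := ople (triangle A B m P) 0.

Definition preserves_order A B : Prop :=
  forall X, opge0 X -> opge0 (A * X * B).

End OperatorNotions.

(* Main.v *)
Require Import Defs.
From mathcomp Require Import all_boot all_order all_algebra.
From mathcomp Require Import complex.
From mathcomp Require Import all_classical all_reals all_analysis.
From mathcomp Require Import ring lra.

Import Order.TTheory GRing.Theory Num.Theory.
Import numFieldNormedType.Exports.
Local Open Scope classical_set_scope.
Local Open Scope ring_scope.

Set Implicit Arguments.
Unset Strict Implicit.
Unset Printing Implicit Defensive.

(** Testing order preservation on rank one operators gives
    [<B x, v> <A v, x> >= 0] for all [x] and [v]. Expansivity makes [B] injective,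
    since on the kernel of [B] the form of [triangle A B m P] is that of [P], and
    then the inequality forces [A = c B^*] for a constant [c >= 0]
    ([preserves_order_adjoint]).

    Fix [x] and put [f n = <A^n P B^n x, x> = c ^ n <P B^n x, B^n x>]. Power
    boundedness makes [f] bounded, and expansivity says that
    [(1 - E) ^ m f <= 0], where [E] is the shift. For a bounded sequence the
    exponent can be lowered down to 1 ([bounded_iter_bdiff_le0]), so [f] is
    nondecreasing. In particular [f n >= f 0 = <P x, x>], which is at least a
    positive multiple of [|x| ^ 2]; together with power boundedness of [A] and
    [B] this bounds [c ^ n] and [c ^ - n], so [c = 1] and [A = B^*].

    The operators [A^n P B^n] are now positive, nondecreasing and bounded, so they
    converge strongly to an operator [Q] ([monotone_strong_limit]), which is
    bounded below and satisfies [A Q B = Q]. A multiple of [Q] is [1 - D] with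
    [|D| < 1], and has a positive invertible square root [S]
    ([sqrt_one_minus], [neumann]). The invariance of [Q] says that
    [V = S B S^-1] is an isometry. Hence [B = S^-1 V S], and taking adjoints,
    [A = S V^* S^-1].

    Most of the argument uses only the real part of the inner product, so that
    estimates live in the ordered field [R]; the complex structure enters through
    order preservation and polarization. *)

(** * The real norm and the real inner product *)

Section RealForms.
Context {R : realType} {H : hilbertType R}.
Implicit Types (x y z : H) (T : 'B(H)) (a : R).

(** The norm of [H] takes its values in [R[i]]; [nrm] is the same norm as a
    real number. *)
Definition nrm x : R := complex.Re `|x|.
(** The real part of the inner product: a real inner product on [H] with the
    same norm. *)
Definition rip x y : R := complex.Re (inner x y).

Lemma nrmE x : `|x| = (nrm x)%:C%C.
Proof. by rewrite /nrm RRe_real// realE normr_ge0. Qed.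

Lemma nrm_ge0 x : 0 <= nrm x.
Proof. by rewrite -lecR -nrmE normr_ge0. Qed.

Lemma nrm_eq0 x : (nrm x == 0) = (x == 0).
Proof. by rewrite -(normr_eq0 x) nrmE; rewrite -[0 in RHS]/(0%:C%C) (inj_eq (@complexI _)). Qed.

Lemma nrm_gt0 x : (0 < nrm x) = (x != 0).
Proof. by rewrite lt_def nrm_eq0 nrm_ge0 andbT. Qed.

Lemma nrmD x y : nrm (x + y) <= nrm x + nrm y.
Proof. by rewrite -lecR rmorphD/= -!nrmE ler_normD. Qed.

Lemma nrmN x : nrm (- x) = nrm x. Proof. by rewrite /nrm normrN. Qed.

Lemma nrmZ (a : R[i]) x : (nrm (a *: x))%:C%C = `|a| * (nrm x)%:C%C.
Proof. by rewrite -!nrmE normrZ. Qed.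

Lemma nrmZr a x : nrm (a%:C%C *: x) = `|a| * nrm x.
Proof. by apply: (@complexI _); rewrite nrmZ rmorphM/= normc_def/= expr0n/= addr0 sqrtr_sqr. Qed.

Lemma ReD (u v : R[i]) : complex.Re (u + v) = complex.Re u + complex.Re v.
Proof. by case: u v => ? ? [? ?]. Qed.
Lemma ReN (u : R[i]) : complex.Re (- u) = - complex.Re u.
Proof. by case: u. Qed.
Lemma Re_conj (u : R[i]) : complex.Re (u^*) = complex.Re u.
Proof. by case: u. Qed.
Lemma ReZ a (u : R[i]) : complex.Re (a%:C%C * u) = a * complex.Re u.
Proof. by case: u => ? ? /=; rewrite mul0r subr0. Qed.

Lemma rip_sqr x : rip x x = nrm x ^+ 2.
Proof. rewrite /rip -sqr_norm_inner nrmE -rmorphXn//. Qed.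

Lemma innerC x y : inner x y = (inner y x)^*.
Proof. by rewrite (hermC inner) expr0 mul1r. Qed.

Lemma ripC x y : rip x y = rip y x.
Proof. by rewrite /rip innerC Re_conj. Qed.

Lemma ripDl x y z : rip (x + y) z = rip x z + rip y z.
Proof. by rewrite /rip linearDl ReD. Qed.
Lemma ripNl x z : rip (- x) z = - rip x z.
Proof. by rewrite /rip linearNl ReN. Qed.
Lemma ripZl a x z : rip (a%:C%C *: x) z = a * rip x z.
Proof. by rewrite /rip linearZl/= ReZ. Qed.
Lemma ripDr x y z : rip z (x + y) = rip z x + rip z y.
Proof. by rewrite ripC ripDl 2!(ripC z). Qed.
Lemma ripNr x z : rip z (- x) = - rip z x.
Proof. by rewrite ripC ripNl (ripC z). Qed.
Lemma ripZr a x z : rip z (a%:C%C *: x) = a * rip z x.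
Proof. by rewrite ripC ripZl (ripC z). Qed.
Definition ripE := (ripDl, ripDr, ripNl, ripNr, ripZl, ripZr).

(** The Cauchy-Schwarz inequality. *)
Lemma rip_le x y : rip x y <= nrm x * nrm y.
Proof.
have [->|x0] := eqVneq x 0.
  by rewrite /rip linear0l/= mulr_ge0// nrm_ge0.
have [->|y0] := eqVneq y 0.
  by rewrite ripC /rip linear0l/= mulr_ge0// nrm_ge0.
have := sqr_ge0 (nrm ((nrm y)%:C%C *: x - (nrm x)%:C%C *: y)).
rewrite -rip_sqr !ripE (ripC y x) !rip_sqr => h.
have xy0 : 0 < nrm x * nrm y by rewrite mulr_gt0 ?nrm_gt0.
rewrite -(ler_pM2l xy0); nra.
Qed.

Lemma rip_abs_le x y : `|rip x y| <= nrm x * nrm y.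
Proof. by rewrite ler_norml rip_le andbT lerNl -ripNl -(nrmN x) rip_le. Qed.

End RealForms.

(** * Positive and bounded operators *)

Section Operators.
Context {R : realType} {H : hilbertType R}.
Implicit Types (x y z : H) (S T : 'B(H)) (a M : R).

Lemma ReMi (u : R[i]) : complex.Re ('i%C * u) = - complex.Im u.
Proof. by case: u => a b /=; rewrite mul0r mul1r sub0r. Qed.

(** The real parts of a form that is linear in its first argument determine
    the form, because the imaginary part of [<x, y>] is minus the real part of
    [<'i x, y>]. *)
Lemma inner_eqP x y x' y' :
  rip x y = rip x' y' -> rip ('i%C *: x) y = rip ('i%C *: x') y' ->
  inner x y = inner x' y'.
Proof.
rewrite /rip !linearZl/= !ReMi => h1 /oppr_inj h2.
by move: h1 h2; case: (inner x y) => a b; case: (inner x' y') => c d /= -> ->.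
Qed.

Lemma rip_adjoint S T :
  (forall x y, rip (S x) y = rip x (T y)) -> is_adjoint S T.
Proof. by move=> ST x y; apply: inner_eqP => //; rewrite -linearZ/= ST. Qed.

Lemma opge0_rip_ge0 T x : opge0 T -> 0 <= rip (T x) x.
Proof. by move=> /(_ x); rewrite lecE => /andP[]. Qed.

(** Polarization: the values of the quadratic form at ['i x + y], [x] and [y]
    are real. *)
Lemma opge0_sym T : opge0 T -> forall x y, rip (T x) y = rip x (T y).
Proof.
move=> T0 x y; have im0 z : complex.Im (inner (T z) z) = 0.
  by have := T0 z; rewrite lecE => /andP[/eqP].
have := im0 ('i%C *: x + y).
rewrite (linearD T) linearZ/= linearDl/= !linearDr/= !raddfD/= !im0.
rewrite !linearZl/= !linearZr/= addr0.
have -> : (inner (T y) x) = (inner x (T y))^* by rewrite innerC.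
rewrite /rip; case: (inner (T x) y) => a b; case: (inner x (T y)) => c d /=.
case: (inner (T x) x) (im0 x) => e f /= ->; lra.
Qed.

(** Converse of [opge0_rip_ge0] and [opge0_sym]: the symmetry makes the
    complex number [<T x, x>] real. *)
Lemma rip_opge0 T : (forall x y, rip (T x) y = rip x (T y)) ->
  (forall x, 0 <= rip (T x) x) -> opge0 T.
Proof.
move=> Tsym T0 x; rewrite lecE; apply/andP; split; last exact: T0.
have := rip_adjoint Tsym x x; rewrite [in RHS]innerC.
by case: (inner _ _) => a b /= [] /eqP; rewrite -addr_eq0 -mulr2n mulrn_eq0.
Qed.

Lemma bop_nrm_le T : exists2 M : R, 0 <= M & forall x, nrm (T x) <= M * nrm x.
Proof.
have [M M0 TM] := bop_bound T; exists (complex.Re M).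
  by move: M0; rewrite lecE => /andP[].
move=> x; have := TM x; rewrite !nrmE lecE => /andP[_] /=.
by case: M {M0 TM} => c d /=; rewrite mulr0 subr0.
Qed.

Lemma opnorm_le T x : nrm (T x) <= opnorm T * nrm x.
Proof.
have [->|x0] := eqVneq x 0.
  by rewrite linear0 (_ : nrm 0 = 0) ?mulr0//; apply/eqP; rewrite nrm_eq0.
have [M M0 TM] := bop_nrm_le T.
have nx : 0 < nrm x by rewrite nrm_gt0.
rewrite -ler_pdivrMr//.
apply: (@ub_le_sup _ [set complex.Re `|T y| | y in [set y : H | `|y| <= 1]]).
  exists M => _ [y /= y1 <-]; apply: le_trans (TM y) _.
  by rewrite ler_piMr// -lecR -nrmE; exact: y1.
exists ((nrm x)^-1%:C%C *: x) => /=.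
  by rewrite nrmE nrmZr ger0_norm ?invr_ge0 ?nrm_ge0// mulVf ?gt_eqF.
by rewrite linearZ/= -/(nrm _) nrmZr ger0_norm ?invr_ge0 ?nrm_ge0// mulrC.
Qed.

(** A positive operator [T] bounded by [M] as a quadratic form satisfies
    [T ^ 2 <= M T]. In particular [|T x| <= M |x|], and [T x] is small as soon
    as [<T x, x>] is. *)
Lemma opge0_sqr_le T M :
  (forall x y, rip (T x) y = rip x (T y)) -> (forall x, 0 <= rip (T x) x) ->
  (forall x, rip (T x) x <= M * nrm x ^+ 2) ->
  forall x, nrm (T x) ^+ 2 <= M * rip (T x) x.
Proof.
move=> Ts T0 TM x; have [Mpos|M0] := ltP 0 M.
  (* The form of T at M x - T x is at most M ^ 2 <T x, x> - M |T x| ^ 2. *)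
  have := T0 (M%:C%C *: x - T x).
  rewrite linearB linearZ/= !ripE.
  have -> : rip (T (T x)) x = nrm (T x) ^+ 2 by rewrite Ts rip_sqr.
  have := TM (T x); rewrite !rip_sqr.
  set t := nrm _ ^+ 2; set s := rip (T x) x; set u := rip _ _ => h1 h2.
  rewrite -(ler_pM2l Mpos); nra.
(* If M <= 0 the quadratic form of T vanishes, hence so does T. *)
have Tx y : rip (T y) y = 0.
  by apply/eqP; rewrite eq_le T0 andbT (le_trans (TM y))// mulr_le0_ge0 ?sqr_ge0.
have := T0 (x - T x); rewrite linearB/= !ripE !Tx.
have -> : rip (T (T x)) x = nrm (T x) ^+ 2 by rewrite Ts rip_sqr.
rewrite !rip_sqr; nra.
Qed.

Lemma bop_of_linear (f : H -> H) M : linear f ->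
  (forall x, nrm (f x) <= M * nrm x) -> exists T : 'B(H), forall x, T x = f x.
Proof.
move=> fl fM; suff fb : bounded_linear_op f by exists (Bop (bop_subproof fb)).
split=> //; exists M%:C%C => x.
by rewrite !nrmE -rmorphM/= lecR.
Qed.

Fact bop_scale_subproof a T : bounded_linear_op (fun x => a%:C%C *: T x).
Proof.
have [M _ TM] := bop_nrm_le T; split=> [b x y|].
  by rewrite linearP scalerDr !scalerA mulrC.
exists (`|a| * M)%:C%C => x; rewrite !nrmE -rmorphM/= lecR nrmZr -mulrA.
by rewrite ler_wpM2l.
Qed.

(** The product of an operator by a real scalar. *)
Definition bop_scale a T : 'B(H) := Bop (bop_subproof (bop_scale_subproof a T)).

End Operators.

(** * Strong limits of operators *)

Section Limits.
Context {R : realType} {H : hilbertType R}.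
Implicit Types (x y z l : H) (S T : 'B(H)) (a M : R) (u : nat -> H).

(** Convergence in [H], whose distances live in [R[i]], read in [R]. *)
Lemma nrm_cvgP u l : (u n @[n --> \oo] --> l) <->
  (nrm (l - u n) @[n --> \oo] --> (0 : R)).
Proof.
split=> [/cvgrPdist_lt ul|/cvgrPdist_lt ul].
  apply/cvgrPdist_lt => e e0.
  have e0' : 0 < e%:C%C :> R[i] by rewrite ltcR.
  near=> n; rewrite sub0r normrN ger0_norm ?nrm_ge0// -ltcR -nrmE.
  by near: n; exact: ul e0'.
apply/cvgrPdist_lt => e; rewrite ltcE /= => /andP[/eqP Ime Ree].
near=> n; rewrite nrmE ltcE /= Ime eqxx/=.
by rewrite -[ltLHS]ger0_norm ?nrm_ge0// -normrN -sub0r; near: n; exact: ul.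
Unshelve. all: by end_near. Qed.

Lemma nrm_cauchy_cvg u :
  (forall e : R, 0 < e ->
    exists N, forall n k, (N <= n)%N -> nrm (u (n + k)%N - u n) <= e) ->
  exists l, u n @[n --> \oo] --> l.
Proof.
move=> uc; suff : cvgn u by move=> ul; exists (limn u).
apply/cauchy_cvgP/cauchy_exP => e; rewrite ltcE /= => /andP[/eqP Ime Ree].
have [|N uN] := uc (complex.Re e / 2); first by rewrite divr_gt0.
exists (u N); near=> n; rewrite -ball_normE /= nrmE ltcE/= Ime eqxx/=.
have nN : (N <= n)%N by near: n; exact: nbhs_infty_ge.
rewrite -nrmN opprB -(subnKC nN) (le_lt_trans (uN _ _ _))// ltr_pdivrMr//; lra.
Unshelve. all: by end_near. Qed.

(** A sequence whose increments are dominated by a geometric sequence of ratio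
    less than 1 converges. *)
Lemma geometric_cvg u a M : 0 <= a < 1 ->
  (forall n, nrm (u n.+1 - u n) <= M * a ^+ n) -> exists l, u n @[n --> \oo] --> l.
Proof.
move=> /andP[a0 a1] ua.
have M0 : 0 <= M by have := ua 0%N; rewrite expr0 mulr1; apply: le_trans; exact: nrm_ge0.
have ca : 0 < 1 - a by rewrite subr_gt0.
have tel n k : (1 - a) * nrm (u (n + k)%N - u n) <= M * a ^+ n * (1 - a ^+ k).
  elim: k => [|k IHk].
    by rewrite addn0 subrr expr0 subrr mulr0 (_ : nrm 0 = 0) ?mulr0//; apply/eqP; rewrite nrm_eq0.
  rewrite addnS -(subrK (u (n + k)%N) (u _.+1)) -addrA.
  apply: le_trans (ler_wpM2l (ltW ca) (nrmD _ _)) _.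
  have := ler_wpM2l (ltW ca) (ua (n + k)%N); rewrite exprD exprS.
  move: IHk; set p := a ^+ n; set q := a ^+ k; lra.
apply: nrm_cauchy_cvg => e e0.
have : GRing.exp a @ \oo --> (0 : R) by apply: cvg_expr; rewrite ger0_norm.
have e'0 : 0 < e * (1 - a) / (M + 1) by rewrite divr_gt0 ?mulr_gt0// ltr_wpDl.
move=> /cvgrPdist_lt/(_ _ e'0)[N _ aN]; exists N => n k Nn.
rewrite -(ler_pM2l ca) (le_trans (tel n k))//.
have := aN n Nn; rewrite /= sub0r normrN ger0_norm ?exprn_ge0// ltr_pdivlMr ?ltr_wpDl//.
have := exprn_ge0 n a0; have := exprn_ge0 k a0.
set p := a ^+ n; set q := a ^+ k => q0 p0 h.
have : 0 <= M * p * q by rewrite !mulr_ge0.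
lra.
Qed.

Lemma cvg_majorized (v : nat -> R) c M u l :
  (forall n, `|c - v n| <= M * nrm (l - u n)) ->
  u n @[n --> \oo] --> l -> v n @[n --> \oo] --> c.
Proof.
move=> vM /nrm_cvgP ul.
have vc0 : `|v n - c| @[n --> \oo] --> (0 : R).
  apply: (squeeze_cvgr (f := fun=> 0) (h := fun n => M * nrm (l - u n))).
  - by near=> n; rewrite normr_ge0 distrC vM.
  - exact: cvg_cst.
  - by rewrite -(mulr0 M); apply: cvgMr.
by apply/subr_cvg0; apply: norm_cvg0; exact: vc0.
Unshelve. all: by end_near. Qed.

Lemma cvg_nrm_majorized v l' M u l :
  (forall n, nrm (l' - v n) <= M * nrm (l - u n)) ->
  u n @[n --> \oo] --> l -> v n @[n --> \oo] --> l'.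
Proof.
move=> vM ul; apply/nrm_cvgP; apply: cvg_majorized ul => n.
by rewrite sub0r normrN ger0_norm ?nrm_ge0 ?vM.
Qed.

Lemma cvg_rip x u l : u n @[n --> \oo] --> l ->
  rip (u n) x @[n --> \oo] --> rip l x.
Proof.
apply: (@cvg_majorized _ _ (nrm x)) => n.
by rewrite -ripNl -ripDl mulrC rip_abs_le.
Qed.

Lemma cvg_bop T u l : u n @[n --> \oo] --> l -> T (u n) @[n --> \oo] --> T l.
Proof.
have [M _ TM] := bop_nrm_le T.
by apply: (@cvg_nrm_majorized _ _ M) => n; rewrite -linearB TM.
Qed.

Lemma cvg_nrm_le M u l : u n @[n --> \oo] --> l ->
  (forall n, nrm (u n) <= M) -> nrm l <= M.
Proof.
move=> ul uM; apply: (cvgr_to_le (F := \oo) (f := fun n => nrm (u n))).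
  apply: (@cvg_majorized _ _ 1) ul => n; rewrite mul1r.
  rewrite ler_norml; apply/andP; split.
    by rewrite lerNl opprB lerBlDr -(nrmN (l - _)) opprB (le_trans _ (nrmD _ _))// subrK.
  by rewrite lerBlDr (le_trans _ (nrmD _ _))// subrK.
by near=> n; exact: uM.
Unshelve. all: by end_near. Qed.

(** The pointwise limit of a uniformly bounded sequence of operators is a
    bounded operator. *)
Lemma strong_limit (T_ : nat -> 'B(H)) M :
  (forall n x, nrm (T_ n x) <= M * nrm x) ->
  (forall x, exists l, T_ n x @[n --> \oo] --> l) ->
  exists T, (forall x, T_ n x @[n --> \oo] --> T x) /\
            (forall x, nrm (T x) <= M * nrm x).
Proof.
move=> TM /choice[f fT].
have fM x : nrm (f x) <= M * nrm x by exact: cvg_nrm_le (fT x) _.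
have fl : linear f.
  move=> a x y; apply: (cvg_unique (@norm_hausdorff _ H) (fT _)).
  have -> : (fun n => T_ n (a *: x + y)) = (fun n => a *: T_ n x + T_ n y).
    by apply/funext => n; rewrite linearP.
  by apply: cvgD => //; apply: cvgZr.
have [T Tf] := bop_of_linear fl fM.
by exists T; split=> x; rewrite Tf.
Qed.

Lemma cvg_bop_comp (T_ : nat -> 'B(H)) T M u l :
  (forall n x, nrm (T_ n x) <= M * nrm x) ->
  (forall x, T_ n x @[n --> \oo] --> T x) -> u n @[n --> \oo] --> l ->
  T_ n (u n) @[n --> \oo] --> T l.
Proof.
move=> TM TT ul.
have -> : (fun n => T_ n (u n)) = (fun n => T_ n l - T_ n (l - u n)).
  by apply/funext => n; rewrite linearB opprB addrC subrK.
rewrite -[T l]subr0; apply: cvgB => //.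
by apply: (cvg_nrm_majorized (M := M)) ul => n; rewrite sub0r nrmN TM.
Qed.

Lemma sym_limit (T_ : nat -> 'B(H)) T :
  (forall n x y, rip (T_ n x) y = rip x (T_ n y)) ->
  (forall x, T_ n x @[n --> \oo] --> T x) ->
  forall x y, rip (T x) y = rip x (T y).
Proof.
move=> Ts TT x y; rewrite (ripC x).
have := cvg_rip (x := x) (TT y).
have -> : (fun n => rip (T_ n y) x) = (fun n => rip (T_ n x) y).
  by apply/funext => n; rewrite Ts ripC.
by move=> /(cvg_unique (@norm_hausdorff _ R) (cvg_rip (x := y) (TT x))); apply.

Qed.

(** A nondecreasing bounded sequence of positive operators converges strongly. *)
Lemma monotone_strong_limit (T_ : nat -> 'B(H)) M C :
  (forall n x, nrm (T_ n x) <= M * nrm x) ->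
  (forall n x y, rip (T_ n x) y = rip x (T_ n y)) ->
  (forall n x, 0 <= rip (T_ n x) x <= C * nrm x ^+ 2) ->
  (forall n x, rip (T_ n x) x <= rip (T_ n.+1 x) x) ->
  exists T, forall x, T_ n x @[n --> \oo] --> T x.
Proof.
move=> TM Ts TC Ti.
suff Tc x : exists l, T_ n x @[n --> \oo] --> l.
  by have [T [? _]] := strong_limit TM Tc; exists T.
have Tn y : nondecreasing_seq (fun n => rip (T_ n y) y).
  by apply/nondecreasing_seqP => n; exact: Ti.
have Tb : has_ubound (range (fun n => rip (T_ n x) x)).
  by exists (C * nrm x ^+ 2) => _ [n _ <-]; have /andP[] := TC n x.
have /cvg_cauchy/cauchy_ballP rc := nondecreasing_is_cvgn (Tn x) Tb.
apply: nrm_cauchy_cvg => e e0.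
have e'0 : 0 < e ^+ 2 / (`|C| + 1) by rewrite divr_gt0 ?exprn_gt0// ltr_wpDl.
have := nondecreasing_cvgn (Tn x) Tb => /cvgrPdist_lt/(_ _ e'0)[N _ NT].
exists N => n k Nn; pose D := T_ (n + k)%N - T_ n.
have DE y : rip (D y) y = rip (T_ (n + k)%N y) y - rip (T_ n y) y.
  by rewrite -ripNl -ripDl.
(* The increments D are positive, so |D x| ^ 2 <= |C| <D x, x>, and the numbers
   <T_ n x, x> form a Cauchy sequence. *)
have : nrm (D x) ^+ 2 <= `|C| * rip (D x) x.
  apply: opge0_sqr_le => [y z|y|y].
  - by rewrite [D y]/= [D z]/= !ripE !Ts.
  - by rewrite DE subr_ge0; apply: (Tn y); rewrite leq_addr.
  rewrite DE; have /andP[_ h] := TC (n + k)%N y; have /andP[h' _] := TC n y.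
  have : C * nrm y ^+ 2 <= `|C| * nrm y ^+ 2 by rewrite ler_wpM2r ?sqr_ge0 ?ler_norm.
  lra.
rewrite -[D x]/(T_ (n + k)%N x - T_ n x) => h.
rewrite -(@ler_pXn2r _ 2) ?nnegrE ?nrm_ge0 ?(ltW e0)//; apply: (le_trans h).
have := NT n Nn; rewrite /= ltr_pdivlMr ?ltr_wpDl// => h2.
have h3 : rip (D x) x <= sup (range (fun n => rip (T_ n x) x)) - rip (T_ n x) x.
  by rewrite DE lerD2r; apply: ub_le_sup => //; exists (n + k)%N.
have h4 : 0 <= rip (D x) x by rewrite DE subr_ge0; apply: (Tn x); rewrite leq_addr.
move: h2; rewrite ger0_norm ?(le_trans h4)// => h2.
have : rip (D x) x * (`|C| + 1) <=
   (sup (range (fun n => rip (T_ n x) x)) - rip (T_ n x) x) * (`|C| + 1).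
  by rewrite ler_wpM2r// addr_ge0.
lra.
Qed.

End Limits.

(** * Inverses and square roots near the identity *)

Section Contractions.
Context {R : realType} {H : hilbertType R}.
Implicit Types (x y z l : H) (S T D Y : 'B(H)) (q M : R).

Lemma contraction_eq0 Y q x : q < 1 -> (forall x, nrm (Y x) <= q * nrm x) ->
  Y x = x -> x = 0.
Proof.
move=> q1 Yq Yx; apply/eqP; rewrite -nrm_eq0 eq_le nrm_ge0 andbT.
have := Yq x; rewrite Yx; have := nrm_ge0 x; nra.
Qed.

(** The inverse is the strong limit of the iteration [S := 1 + Y S], the partial
    sums of the Neumann series. *)
Lemma neumann Y q : 0 <= q < 1 -> (forall x, nrm (Y x) <= q * nrm x) ->
  exists S, is_inverse (1 - Y) S.
Proof.
move=> /andP[q0 q1] Yq.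
pose S_ n : 'B(H) := iter n (fun S => 1 + Y * S) 0.
have SE n x : S_ n.+1 x = x + Y (S_ n x) by [].
have Sd n x : nrm (S_ n.+1 x - S_ n x) <= nrm x * q ^+ n.
  elim: n => [|n IHn]; first by rewrite SE /= linear0 addr0 subr0 mulr1.
  rewrite 2!SE opprD addrACA subrr add0r -linearB (le_trans (Yq _))// exprS mulrCA.
  by rewrite ler_wpM2l.
have Sb n x : nrm (S_ n x) <= (1 - q)^-1 * nrm x.
  have c0 : 0 < 1 - q by rewrite subr_gt0.
  elim: n => [|n IHn].
    by rewrite /= -[X in nrm X](scale0r x) nrmZr normr0 mul0r mulr_ge0 ?invr_ge0 ?nrm_ge0 ?ltW.
  rewrite SE (le_trans (nrmD _ _))//.
  have h := le_trans (Yq (S_ n x)) (ler_wpM2l q0 IHn).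
  apply: le_trans (lerD (lexx _) h) _.
  rewrite mulrA -[X in X + _]mul1r -mulrDl ler_wpM2r ?nrm_ge0//.
  by rewrite le_eqVlt; apply/orP; left; apply/eqP; field; rewrite gt_eqF.
have [|S [SS _]] := strong_limit Sb.
  by move=> x; apply: (@geometric_cvg _ _ _ q (nrm x)) => //; rewrite q0.
have S1 x : S x = x + Y (S x).
  have h : S_ n.+1 x @[n --> \oo] --> x + Y (S x).
    by apply: cvgD; [exact: cvg_cst|exact/cvg_bop].
  have h' : S_ n.+1 x @[n --> \oo] --> S x by rewrite (cvg_shiftS (fun n => S_ n x)).
  exact: (cvg_unique (@norm_hausdorff _ H) h' h).
exists S; split; apply: bop_eqP => x.
  by rewrite -[LHS]/(S x - Y (S x)) {1}S1 addrK.
(* S is a right inverse of 1 - Y by construction; it is a left inverse because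
   1 - Y is injective. *)
apply/eqP; rewrite -subr_eq0; apply/eqP.
apply: (contraction_eq0 q1 Yq).
rewrite -[(S * (1 - Y)) x - _]/(S (x - Y x) - x).
rewrite linearB [in RHS]S1 [RHS]addrAC (addrAC x) subrr add0r addrC.
by [].
Qed.

(** A square root of [1 - D] for a symmetric strict contraction [D]: it is
    [1 - Y], where [Y] is the fixed point of [Y := (D + Y ^ 2) / 2]. The
    iteration from 0 stays in the ball of radius [q], since [(q + q ^ 2) / 2 <= q],
    and contracts there with ratio [q]. *)
Lemma sqrt_one_minus D q : 0 <= q < 1 ->
  (forall x y, rip (D x) y = rip x (D y)) -> (forall x, nrm (D x) <= q * nrm x) ->
  exists Y : 'B(H), [/\ forall x y, rip (Y x) y = rip x (Y y),
    forall x, nrm (Y x) <= q * nrm x & (1 - Y) * (1 - Y) = 1 - D].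
Proof.
move=> /andP[q0 q1] Ds Dq.
pose Y_ n : 'B(H) := iter n (fun Y => bop_scale 2^-1 (D + Y * Y)) 0.
have YE n x : Y_ n.+1 x = 2^-1%:C%C *: (D x + Y_ n (Y_ n x)) by [].
have Y0 x : Y_ 0%N x = 0 by [].
have Yq n x : nrm (Y_ n x) <= q * nrm x.
  elim: n x => [|n IHn] x.
    by rewrite /= -[X in nrm X](scale0r x) nrmZr normr0 mul0r mulr_ge0 ?nrm_ge0.
  rewrite YE nrmZr ger0_norm ?invr_ge0//.
  have h1 := nrmD (D x) (Y_ n (Y_ n x)).
  have h2 := IHn (Y_ n x); have h3 := ler_wpM2l q0 (IHn x); have h4 := Dq x.
  have : q * (q * nrm x) <= q * nrm x.
    by rewrite ler_wpM2l// ler_piMl ?nrm_ge0// ltW.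
  lra.
have Ys n x y : rip (Y_ n x) y = rip x (Y_ n y).
  elim: n x y => [|n IHn] x y.
    by rewrite /= /rip linear0l linear0r.
  by rewrite !YE !ripE Ds !IHn.
have Yd n x : nrm (Y_ n.+1 x - Y_ n x) <= nrm x * q ^+ n.
  elim: n x => [|n IHn] x.
    rewrite YE !Y0 addr0 subr0 mulr1 nrmZr ger0_norm ?invr_ge0//.
    have := Dq x; have := nrm_ge0 x; have := nrm_ge0 (D x); nra.
  rewrite (YE n.+1) [X in _ - X](YE n) -scalerBr opprD addrACA subrr add0r.
  rewrite nrmZr ger0_norm ?invr_ge0//.
  (* V V x - U U x = V (V x - U x) + (V - U) (U x), with no need for U and V to
     commute. *)
  rewrite -(subrK (Y_ n.+1 (Y_ n x)) (Y_ n.+1 (Y_ n.+1 x))) -addrA -linearB.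
  have h1 := nrmD (Y_ n.+1 (Y_ n.+1 x - Y_ n x)) (Y_ n.+1 (Y_ n x) - Y_ n (Y_ n x)).
  have h2 := Yq n.+1 (Y_ n.+1 x - Y_ n x).
  have h3 := ler_wpM2l q0 (IHn x).
  have h4 := IHn (Y_ n x).
  have h5 := ler_wpM2r (exprn_ge0 n q0) (Yq n x).
  rewrite exprS; move: h1 h2 h3 h4 h5; set p := q ^+ n.
  lra.
have [|Y [YY Yb]] := strong_limit Yq.
  by move=> x; apply: (@geometric_cvg _ _ _ q (nrm x)) => //; rewrite q0.
have Yfix x : Y x = 2^-1%:C%C *: (D x + Y (Y x)).
  have h : Y_ n.+1 x @[n --> \oo] --> 2^-1%:C%C *: (D x + Y (Y x)).
    by apply: cvgZr; apply: cvgD; [exact: cvg_cst|apply: (cvg_bop_comp Yq YY)].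
  have h' : Y_ n.+1 x @[n --> \oo] --> Y x by rewrite (cvg_shiftS (fun n => Y_ n x)).
  exact: (cvg_unique (@norm_hausdorff _ H) h' h).
exists Y; split=> //; first exact: sym_limit Ys YY.
apply: bop_eqP => x.
rewrite -[LHS]/(x - Y x - Y (x - Y x)) -[RHS]/(x - D x) linearB opprB.
rewrite -!addrA; congr (_ + _).
have h : Y x + Y x = D x + Y (Y x).
  rewrite [in LHS]Yfix -scalerDl -rmorphD/= (_ : 2^-1 + 2^-1 = 1 :> R) ?scale1r//; lra.
by rewrite addrCA -opprD h opprD addrCA subrr addr0.
Qed.

End Contractions.

(** * Pairs of operators preserving order *)

Section OrderPreserving.
Context {R : realType} {H : hilbertType R}.
Implicit Types (v w x y z : H) (A B X : 'B(H)).

Lemma innerDl x y z : inner (x + y) z = inner x z + inner y z.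
Proof. exact: linearDl. Qed.
Lemma innerDr x y z : inner z (x + y) = inner z x + inner z y.
Proof. exact: linearDr. Qed.
Lemma innerZl (a : R[i]) x z : inner (a *: x) z = a * inner x z.
Proof. exact: linearZl. Qed.
Lemma innerZr (a : R[i]) x z : inner z (a *: x) = a^* * inner z x.
Proof. exact: linearZr. Qed.

(** The Cauchy-Schwarz inequality for the modulus of the complex inner product. *)
Lemma inner_norm_le x y : `|inner x y| <= `|x| * `|y|.
Proof.
set z := inner x y; pose m : R := complex.Re `|z|.
have zm : `|z| = m%:C%C by rewrite /m RRe_real// realE normr_ge0.
have m0 : 0 <= m by rewrite -lecR -zm normr_ge0.
rewrite zm !nrmE -rmorphM/= lecR.
(* Multiplying x by the conjugate of z turns the inner product into |z| ^ 2. *)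
have := rip_le (z^* *: x) y.
have -> : rip (z^* *: x) y = m ^+ 2.
  by rewrite /rip linearZl/= -/z mulrC -normCK zm -rmorphXn.
have -> : nrm (z^* *: x) = m * nrm x.
  by apply: (@complexI _); rewrite nrmZ norm_conjC zm -rmorphM.
move: m0; rewrite le_eqVlt => /predU1P[<- _|m0].
  by rewrite mulr_ge0 ?nrm_ge0.
by rewrite expr2 -mulrA ler_pM2l.
Qed.

(** The operator [x |-> <x, v> v]. *)
Lemma rank_one v : exists X, forall x, X x = inner x v *: v.
Proof.
pose M := complex.Re `|v| ^+ 2.
apply: (@bop_of_linear _ _ _ M) => [a x y|x].
  by rewrite linearPl/= scalerDl scalerA.
rewrite -lecR rmorphM/= nrmZ rmorphXn/= -/(nrm v) -!nrmE expr2 mulrAC.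
by rewrite ler_wpM2r ?normr_ge0// mulrC inner_norm_le.
Qed.

Lemma preserves_order_rank_one A B x v : preserves_order A B ->
  0 <= inner (B x) v * inner (A v) x.
Proof.
have [X Xv] := rank_one v => /(_ X).
have X0 : opge0 X.
  by move=> y; rewrite Xv linearZl/= innerC -normCKC exprn_ge0.
by move=> /(_ X0 x); rewrite -[(A * X * B) x]/(A (X (B x))) Xv linearZ/= innerZl.
Qed.

(** Perturbing [v] to [v - r a (B x)] with [a = <A v, x>] makes the product of
    [preserves_order_rank_one] a negative multiple of [|a| ^ 2]. *)
Lemma preserves_order_orthogonal A B x v : preserves_order A B -> B x != 0 ->
  inner (B x) v = 0 -> inner (A v) x = 0.
Proof.
move=> AB Bx0 Bxv; set a := inner (A v) x.
set w := B x; pose n := inner w w; pose b := inner (A w) x.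
have n0 : 0 < n by rewrite /n -sqr_norm_inner exprn_gt0// normr_gt0.
have b0 : 0 <= b.
  by rewrite -(pmulr_rge0 _ n0); exact: preserves_order_rank_one.
have b1 : 0 < 1 + b by rewrite ltr_wpDr.
(* Any r with 0 < r and r b < 1 would do. *)
pose r := (1 + b)^-1.
have r0 : 0 < r by rewrite invr_gt0.
have := preserves_order_rank_one x (v + (- (r * a)) *: w) AB.
have -> : A (v + - (r * a) *: w) = A v + - (r * a) *: A w.
  by rewrite linearD linearZ.
rewrite innerDr innerZr Bxv add0r innerDl innerZl.
rewrite -/w -/n -/a -/b rmorphN rmorphM/= (CrealP (gtr0_real r0)).
have -> : - (r * a^*) * n * (a + - (r * a) * b) = - (r ^+ 2 * n * (a * a^*)).
  by rewrite /r; field; rewrite gt_eqF.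
rewrite oppr_ge0 pmulr_rle0 ?mulr_gt0 ?exprn_gt0// -normCK => h.
by apply/eqP; rewrite -normr_eq0 -sqrf_eq0 eq_le h exprn_ge0.
Qed.

(** The functional [<A v, x>] of [v] vanishes on the orthogonal of [B x], hence
    is a multiple of [<v, B x>]. *)
Lemma preserves_order_pointwise A B x : preserves_order A B ->
  (forall y, B y = 0 -> y = 0) ->
  exists2 d, 0 <= d & forall v, inner (A v) x = d * inner v (B x).
Proof.
move=> AB Binj; have [->|x0] := eqVneq x 0.
  by exists 0 => // v; rewrite linear0r mul0r.
have Bx0 : B x != 0 by apply: contra_neq x0; exact: Binj.
pose n := inner (B x) (B x).
have n0 : 0 < n by rewrite /n -sqr_norm_inner exprn_gt0// normr_gt0.
exists (inner (A (B x)) x / n).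
  rewrite divr_ge0 ?(ltW n0)// -(pmulr_rge0 _ n0).
  exact: preserves_order_rank_one.
move=> v; pose v' := v - (inner v (B x) / n) *: B x.
have := @preserves_order_orthogonal A B x v' AB Bx0.
rewrite innerC /v' linearBl linearZl/= -/n divfK ?gt_eqF// subrr conjC0.
move=> /(_ erefl); rewrite linearB linearZ/= linearBl linearZl/= => /eqP.
by rewrite subr_eq0 => /eqP ->; rewrite mulrC mulrA mulrAC.
Qed.

(** If [(A, B)] preserves order and [B] is injective, then [A] is a nonnegative
    multiple of the adjoint of [B]: the factors given by
    [preserves_order_pointwise] do not depend on the vector. *)
Lemma preserves_order_adjoint A B : preserves_order A B ->
  (forall y, B y = 0 -> y = 0) ->
  exists2 c : R, 0 <= c & forall v x, rip (A v) x = c * rip v (B x).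
Proof.
move=> AB Binj.
suff [c c0 cE] : exists2 c : R[i], 0 <= c &
    forall v x, inner (A v) x = c * inner v (B x).
  exists (complex.Re c); first by move: c0; rewrite lecE => /andP[].
  by move=> v x; rewrite /rip cE -{1}(RRe_real (ger0_real c0)) ReZ.
have [[x0 x00]|all0] := pselect (exists x, x != 0); last first.
  exists 0 => // v x; rewrite (_ : x = 0) ?linear0r ?mul0r//.
  by apply/eqP/negPn/negP => xn; apply: all0; exists x.
have [c c0 cE] := preserves_order_pointwise x0 AB Binj.
exists c => // v x.
have [d d0 dE] := preserves_order_pointwise x AB Binj.
have [e e0 eE] := preserves_order_pointwise (x + x0) AB Binj.
(* c, d and e are the factors at x0, x and x + x0; comparing them at x + x0 gives
   a linear relation, which B reflects. *)
have h : (e - d) *: x = (c - e) *: x0.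
  apply/eqP; rewrite -subr_eq0; apply/eqP/Binj/eqP.
  set y := B _; rewrite -normr_eq0 -sqrf_eq0 sqr_norm_inner.
  have {2}-> : y = (e - d) *: B x + (e - c) *: B x0.
    by rewrite -(opprB c e) scaleNr /y linearB; congr (_ - _); exact: linearZ.
  have := eE y; rewrite innerDr dE cE linearD !innerDr !innerZr.
  have rconj (s t : R[i]) : 0 <= s -> 0 <= t -> (s - t)^* = s - t.
    by move=> s0 t0; apply/CrealP; rewrite realB ?ger0_real.
  rewrite !rconj//; set p := inner y (B x); set q := inner y (B x0) => E.
  have -> : (e - d) * p + (e - c) * q = e * (p + q) - (d * p + c * q) by ring.
  by rewrite E subrr.
have [ed|ed] := eqVneq e d.
  move: h; rewrite ed subrr scale0r => /esym/eqP; rewrite scaler_eq0.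
  by case/orP => [|/eqP x0E]; [rewrite subr_eq0 => /eqP ->|move: x00; rewrite x0E eqxx].
have -> : x = ((c - e) / (e - d)) *: x0.
  by rewrite mulrC -scalerA -h scalerA mulVf ?scale1r// subr_eq0.
rewrite innerZr cE mulrCA -innerZr; congr (_ * inner v _).
by rewrite linearZ.
Qed.

End OrderPreserving.

(** * Bounded sequences with a signed iterated difference *)

Section Differences.
Context {R : realType}.
Implicit Types (f : nat -> R) (K : R).

(** The difference operator [1 - E], where [E] is the shift of sequences. *)
Definition bdiff f : nat -> R := fun n => f n - f n.+1.

Lemma iter_bdiffE m f n :
  iter m bdiff f n = \sum_(j < m.+1) (-1) ^+ j * f (n + j)%N *+ 'C(m, j).
Proof.
elim: m n => [|m IHm] n.
  by rewrite big_ord_recl big_ord0 /= addr0 expr0 mul1r addn0 bin0 mulr1n.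
rewrite iterS /bdiff !IHm [RHS]big_ord_recl /= expr0 mul1r addn0 bin0 mulr1n.
have -> : \sum_(j < m.+1) (-1) ^+ j * f (n + j)%N *+ 'C(m, j) =
    \sum_(j < m.+2) (-1) ^+ j * f (n + j)%N *+ 'C(m, j).
  by rewrite [RHS]big_ord_recr /= bin_small// mulr0n addr0.
rewrite big_ord_recl /= expr0 mul1r addn0 bin0 mulr1n -addrA; congr (_ + _).
rewrite -sumrB; apply: eq_bigr => j _.
rewrite /bump /= !add1n binS mulrnDr addnS addSn exprS.
by rewrite mulN1r !mulNr !mulNrn.
Qed.

Lemma iter_bdiff_bounded f K m n :
  (forall n, `|f n| <= K) -> `|iter m bdiff f n| <= 2 ^+ m * K.
Proof.
move=> fK; elim: m n => [|m IHm] n; first by rewrite expr0 mul1r.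
rewrite iterS /bdiff (le_trans (ler_normB _ _))// exprS -mulrA mulr2n mulrDl mul1r.
exact: lerD.
Qed.

(** If [(1 - E) ^ 2 f <= 0] then [(1 - E) f] is nondecreasing; a positive value
    would make [f] decrease at least linearly from there on. *)
Lemma bounded_bdiff_le0 f K : (forall n, `|f n| <= K) ->
  (forall n, bdiff (bdiff f) n <= 0) -> forall n, bdiff f n <= 0.
Proof.
move=> fK ddf n; rewrite leNgt; apply/negP => e0; set e := bdiff f n in e0.
have de k : e <= bdiff f (n + k)%N.
  elim: k => [|k IHk]; first by rewrite addn0.
  by rewrite (le_trans IHk)// addnS -subr_le0; exact: ddf.
have fle k : f (n + k)%N <= f n - k%:R * e.
  elim: k => [|k IHk]; first by rewrite addn0 mul0r subr0.
  have := de k; rewrite /bdiff -natr1 addnS; lra.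
pose k := Num.bound (2 * K / e).
have : 2 * K / e < k%:R.
  by apply: archi_boundP; rewrite divr_ge0 ?mulr_ge0 ?(le_trans _ (fK 0%N))// ltW.
rewrite ltr_pdivrMr// => h; have := fle k.
have := fK n; have := fK (n + k)%N; rewrite !ler_norml => /andP[h1 _] /andP[_ h2]; lra.
Qed.

(** For a bounded sequence the order of the difference can be lowered to 1. *)
Lemma bounded_iter_bdiff_le0 f K m : (0 < m)%N -> (forall n, `|f n| <= K) ->
  (forall n, iter m bdiff f n <= 0) -> forall n, f n <= f n.+1.
Proof.
case: m => // m _ fK; elim: m => [|m IHm] dm n; first by rewrite -subr_le0; exact: dm.
apply: IHm => k; rewrite iterS.
by apply: bounded_bdiff_le0 (fun j => iter_bdiff_bounded m j fK) _ k.
Qed.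

Lemma exprn_bounded_le1 (c K : R) : (forall n, c ^+ n <= K) -> c <= 1.
Proof.
move=> cK; rewrite leNgt; apply/negP => c1.
have c0 : 0 < c by rewrite (lt_trans _ c1).
have K0 : 0 < K by rewrite (lt_le_trans _ (cK 0%N))// expr0.
have : GRing.exp c^-1 @ \oo --> (0 : R).
  by apply: cvg_expr; rewrite ger0_norm ?invr_ge0 ?ltW// invf_lt1.
have K'0 : 0 < K^-1 by rewrite invr_gt0.
move=> /cvgrPdist_lt/(_ _ K'0)[N _ /(_ N (leqnn N))] /=.
rewrite sub0r normrN ger0_norm ?exprn_ge0 ?invr_ge0 ?ltW// exprVn.
by rewrite ltf_pV2 ?posrE ?exprn_gt0// ltNge cK.
Qed.

End Differences.

(** * Expansive pairs *)

Section Expansive.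
Context {R : realType} {H : hilbertType R}.
Implicit Types (x y z : H) (A B P Q S T : 'B(H)) (c d C : R).

Lemma rip_bop_sum n (F : 'I_n -> 'B(H)) x y :
  rip ((\sum_(j < n) F j) x) y = \sum_(j < n) rip (F j x) y.
Proof.
apply: (big_morph (fun T : 'B(H) => rip (T x) y)) => [S T|]; first exact: ripDl.
by rewrite /rip linear0l.
Qed.

Lemma rip_bop_mulrn n T x y : rip ((T *+ n) x) y = rip (T x) y *+ n.
Proof.
elim: n => [|n IHn]; first by rewrite !mulr0n /rip linear0l.
by rewrite !mulrS -IHn -ripDl.
Qed.

Lemma rip_bop_sign n T x y : rip (((-1) ^+ n * T) x) y = (-1) ^+ n * rip (T x) y.
Proof.
elim: n => [|n IHn]; first by rewrite !expr0 !mul1r.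
by rewrite !exprS -!mulrA !mulN1r -IHn -ripNl.
Qed.

Lemma rip_triangle A B P m x y : rip (triangle A B m P x) y =
  \sum_(j < m.+1) (-1) ^+ j * rip ((A ^+ j * P * B ^+ j) x) y *+ 'C(m, j).
Proof.
rewrite rip_bop_sum; apply: eq_bigr => j _.
by rewrite rip_bop_mulrn rip_bop_sign.
Qed.

Lemma expansive_rip_le0 A B P m x :
  expansive A B m P -> rip (triangle A B m P x) x <= 0.
Proof.
rewrite /expansive /ople sub0r => /(opge0_rip_ge0 x).
by rewrite -[(- triangle A B m P) x]/(- (triangle A B m P x)) ripNl oppr_ge0.
Qed.

Lemma power_bounded_nrm_le T : power_bounded T ->
  exists2 M : R, 0 < M & forall n x, nrm ((T ^+ n) x) <= M * nrm x.
Proof.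
move=> [M M0 TM]; exists M => // n x; apply: le_trans (opnorm_le _ _) _.
by rewrite ler_wpM2r ?nrm_ge0.
Qed.

(** A positive invertible operator is bounded below as a quadratic form. *)
Lemma invertible_coercive P : opge0 P -> invertible P ->
  exists2 d : R, 0 < d & forall x, d * nrm x ^+ 2 <= rip (P x) x.
Proof.
move=> P0 [S [_ SP]]; have [K K0 PK] := bop_nrm_le P.
have [N N0 SN] := bop_nrm_le S.
have P0' x := opge0_rip_ge0 x P0.
have PKx x : rip (P x) x <= K * nrm x ^+ 2.
  by rewrite (le_trans (rip_le _ _))// expr2 mulrA ler_wpM2r ?nrm_ge0.
have NK : 0 < N ^+ 2 * K + 1 by rewrite ltr_wpDl// mulr_ge0 ?exprn_ge0.
exists (N ^+ 2 * K + 1)^-1; first by rewrite invr_gt0.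
move=> x; rewrite ler_pdivrMl//.
have h1 : nrm x <= N * nrm (P x).
  have -> : x = S (P x) by rewrite -[S (P x)]/((S * P) x) SP.
  have -> : P (S (P x)) = P x by rewrite -[S (P x)]/((S * P) x) SP.
  exact: SN.
have h2 : nrm x ^+ 2 <= N ^+ 2 * nrm (P x) ^+ 2.
  by rewrite -exprMn ler_pXn2r ?nnegrE ?nrm_ge0 ?mulr_ge0 ?nrm_ge0.
have h3 := opge0_sqr_le (opge0_sym P0) P0' PKx x.
have h4 := ler_wpM2l (exprn_ge0 2 N0) h3.
have := P0' x; lra.
Qed.

(** On the kernel of [B] the form of [triangle A B m P] is the form of [P]. *)
Lemma expansive_injective A B P m : opge0 P -> invertible P ->
  expansive A B m P -> forall y, B y = 0 -> y = 0.
Proof.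
move=> P0 Pinv AB y By0; have [d d0 Pd] := invertible_coercive P0 Pinv.
have := expansive_rip_le0 y AB; rewrite rip_triangle big_ord_recl /=.
rewrite big1 => [|j _]; last first.
  have -> : (B ^+ bump 0 j) y = (B ^+ j) (B y) by rewrite /bump add1n exprSr.
  by rewrite By0 !linear0 /rip linear0l mulr0 mul0rn.
rewrite addr0 expr0 bin0 mul1r mulr1n => Py.
apply/eqP; rewrite -nrm_eq0 -sqrf_eq0 eq_le sqr_ge0 andbT.
by rewrite -(pmulr_rle0 _ d0) (le_trans (Pd y)).
Qed.

Lemma rip_expr A B c : (forall v x, rip (A v) x = c * rip v (B x)) ->
  forall n v x, rip ((A ^+ n) v) x = c ^+ n * rip v ((B ^+ n) x).
Proof.
move=> AB; elim=> [|n IHn] v x; first by rewrite !expr0 mul1r.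
rewrite exprS -[(A * _) v]/(A ((A ^+ n) v)) AB IHn mulrA -exprS.
by rewrite (exprSr B).
Qed.

(** For [A = c B^*], the [m]-th difference [(1 - E) ^ m] of [<A^n P B^n x, x>] at [n]
    is the form of [triangle A B m P] at [B^n x], times [c ^ n]; hence it is
    nonpositive, and the sequence is bounded. *)
Lemma expansive_nondecreasing A B P m c (MA MB : R) : (0 < m)%N -> 0 <= c ->
  (forall v x, rip (A v) x = c * rip v (B x)) -> expansive A B m P ->
  0 <= MA -> (forall n x, nrm ((A ^+ n) x) <= MA * nrm x) ->
  (forall n x, nrm ((B ^+ n) x) <= MB * nrm x) ->
  forall n x, rip ((A ^+ n * P * B ^+ n) x) x <=
              rip ((A ^+ n.+1 * P * B ^+ n.+1) x) x.
Proof.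
move=> m0 c0 AB exp MA0 Ab Bb n x.
have [K K0 PK] := bop_nrm_le P.
pose f n := rip ((A ^+ n * P * B ^+ n) x) x.
apply: (@bounded_iter_bdiff_le0 _ f (MA * (K * (MB * nrm x)) * nrm x) m) => // k.
  rewrite /f (le_trans (rip_abs_le _ _))// ler_wpM2r ?nrm_ge0//.
  rewrite (le_trans (Ab _ _))// ler_wpM2l// (le_trans (PK _))//.
  by rewrite ler_wpM2l.
rewrite iter_bdiffE.
pose z := (B ^+ k) x.
have -> : \sum_(j < m.+1) (-1) ^+ j * f (k + j)%N *+ 'C(m, j) =
    c ^+ k * rip (triangle A B m P z) z.
  rewrite rip_triangle mulr_sumr; apply: eq_bigr => j _.
  rewrite mulrnAr mulrCA; congr (_ * _ *+ _).
  by rewrite /f exprD (addnC k) (exprD B) -(rip_expr AB).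
by rewrite mulr_ge0_le0 ?exprn_ge0// expansive_rip_le0.
Qed.

(** An operator [B] leaving invariant a bounded and coercive quadratic form [Q] is
    an isometry for the norm [x |-> |S x|], where [S] is a square root of
    [C^-1 Q]. *)
Lemma invariant_form_isometry B Q d C : 0 < d ->
  (forall x y, rip (Q x) y = rip x (Q y)) ->
  (forall x, d * nrm x ^+ 2 <= rip (Q x) x <= C * nrm x ^+ 2) ->
  (forall x, rip (Q (B x)) (B x) = rip (Q x) x) ->
  exists S Sinv, [/\ opge0 S, is_inverse S Sinv &
    forall x, nrm (S (B x)) = nrm (S x)].
Proof.
move=> d0 Qs QdC QB.
(* A nonzero vector gives d <= C, hence 0 <= q below; the zero space is apart. *)
have [[x0 x00]|all0] := pselect (exists x : H, x != 0); last first.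
  have eq0 x : x = 0 by apply/eqP/negPn/negP => xn; apply: all0; exists x.
  exists 1, 1; split; last by move=> x; rewrite (eq0 (B x)) (eq0 x).
    by move=> x; rewrite (eq0 x) linear0r.
  by split; rewrite mulr1.
have nx0 : 0 < nrm x0 ^+ 2 by rewrite exprn_gt0// nrm_gt0.
have dC : d <= C.
  by have /andP[h1 h2] := QdC x0; rewrite -(ler_pM2r nx0) (le_trans h1).
have C0 : 0 < C by rewrite (lt_le_trans d0).
pose D : 'B(H) := 1 - bop_scale C^-1 Q; pose q := 1 - d / C.
have q01 : 0 <= q < 1.
  by rewrite /q subr_ge0 ler_pdivrMr// mul1r dC gtrBl divr_gt0.
have [q0 q1] := andP q01.
have DE x : D x = x - C^-1%:C%C *: Q x by [].
have Ds x y : rip (D x) y = rip x (D y) by rewrite !DE !ripE Qs.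
have Dx x : rip (D x) x = nrm x ^+ 2 - C^-1 * rip (Q x) x.
  by rewrite DE !ripE rip_sqr.
have D0 x : 0 <= rip (D x) x.
  by rewrite Dx subr_ge0 ler_pdivrMl//; have /andP[] := QdC x.
have Dle x : rip (D x) x <= q * nrm x ^+ 2.
  rewrite Dx /q mulrBl mul1r lerD2l lerN2 mulrAC mulrC ler_wpM2l ?invr_ge0 ?(ltW C0)//.
  by have /andP[] := QdC x.
have Dq x : nrm (D x) <= q * nrm x.
  rewrite -(@ler_pXn2r _ 2) ?nnegrE ?nrm_ge0 ?mulr_ge0 ?nrm_ge0// exprMn.
  rewrite (le_trans (opge0_sqr_le Ds D0 Dle x))// expr2 -mulrA.
  by rewrite ler_wpM2l.
have [Y [Ys Yq YD]] := sqrt_one_minus q01 Ds Dq.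
have [Sinv Sinv1] := neumann q01 Yq.
pose S : 'B(H) := 1 - Y.
have SE x : S x = x - Y x by [].
have Ss x y : rip (S x) y = rip x (S y) by rewrite !SE !ripE Ys.
exists S, Sinv; split=> //.
  apply: rip_opge0 => // x; rewrite SE !ripE rip_sqr subr_ge0.
  rewrite (le_trans (rip_le _ _))// expr2 ler_wpM2r ?nrm_ge0//.
  by rewrite (le_trans (Yq x))// ler_piMl ?nrm_ge0// ltW.
have SQ x : nrm (S x) ^+ 2 = C^-1 * rip (Q x) x.
  rewrite -rip_sqr -Ss -[S (S x)]/((S * S) x) YD.
  rewrite -[(1 - D) x]/(x - D x) DE opprB addrC subrK.
  by rewrite ripZl.
by move=> x; apply: (@pexpIrn _ 2) => //; rewrite ?nnegrE ?nrm_ge0// !SQ QB.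
Qed.

End Expansive.

(** * Similarity to an isometry and to the adjoint of one *)

Theorem theorem3p2 (R : realType) (H : hilbertType R)
  (H_infinite : infinite_dimensional H)
  (m : nat) (m_ge1 : (1 <= m)%N)
  (P : 'B(H)) (P_ge0 : opge0 P) (P_inv : invertible P)
  (A B : 'B(H)) (A_pb : power_bounded A) (B_pb : power_bounded B)
  (AB_order : preserves_order A B) (AB_expansive : expansive A B m P) :
  exists P1 P1inv P2 P2inv V1 V1adj V2 : 'B(H),
    [/\ opge0 P1 /\ is_inverse P1 P1inv,
        opge0 P2 /\ is_inverse P2 P2inv,
        isometric V1 /\ is_adjoint V1 V1adj,
        isometric V2 &
        A = P1inv * V1adj * P1 /\ B = P2inv * V2 * P2].
Proof.
have [d d0 Pd] := invertible_coercive P_ge0 P_inv.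
have [MA MA0 Ab] := power_bounded_nrm_le A_pb.
have [MB MB0 Bb] := power_bounded_nrm_le B_pb.
have [K K0 PK] := bop_nrm_le P.
have [c c0 AB] := preserves_order_adjoint AB_order
  (expansive_injective P_ge0 P_inv AB_expansive).
pose T n : 'B(H) := A ^+ n * P * B ^+ n.
have Tnd n x := expansive_nondecreasing m_ge1 c0 AB AB_expansive (ltW MA0) Ab Bb n x.
have Tb n x : nrm (T n x) <= MA * (K * MB) * nrm x.
  rewrite -!mulrA (le_trans (Ab _ _))// ler_wpM2l ?(ltW MA0)// (le_trans (PK _))//.
  by rewrite ler_wpM2l.
have Td n x : d * nrm x ^+ 2 <= rip (T n x) x.
  elim: n => [|n IHn]; last exact: le_trans IHn (Tnd n x).
  by rewrite /T !expr0 mul1r mulr1.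
have TE n x : rip (T n x) x = c ^+ n * rip (P ((B ^+ n) x)) ((B ^+ n) x).
  by rewrite -[T n x]/((A ^+ n) (P ((B ^+ n) x))) (rip_expr AB).
have Tup n x : rip (T n x) x <= c ^+ n * K * nrm ((B ^+ n) x) ^+ 2.
  rewrite TE -mulrA ler_wpM2l ?exprn_ge0// (le_trans (rip_le _ _))//.
  by rewrite expr2 mulrA ler_wpM2r ?nrm_ge0.
(* Powers of c are bounded from both sides: by coercivity c ^ n |B^n x| ^ 2 is
   bounded below, while |B^n x| and c ^ n |B^n x| are bounded above, the latter
   because c ^ n B^n is the adjoint of A^n. *)
have [x0 x00] : exists x : H, x != 0.
  have [x xn] := H_infinite 0%N (fun=> 0); exists x; apply/eqP.
  by have := xn (fun=> 0); rewrite big_ord0.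
have nx0 : 0 < nrm x0 ^+ 2 by rewrite exprn_gt0// nrm_gt0.
have cn0 n : 0 < c ^+ n.
  have := lt_le_trans (mulr_gt0 d0 nx0) (le_trans (Td n x0) (Tup n x0)).
  by rewrite -mulrA lt0r mulf_eq0 negb_or => /andP[/andP[cn _] _]; rewrite lt0r cn exprn_ge0.
have cpos : 0 < c by have := cn0 1%N; rewrite expr1.
have c_ge1 : 1 <= c.
  rewrite -invf_le1//; apply: (@exprn_bounded_le1 _ _ (K * MB ^+ 2 / d)) => n.
  have h1 : nrm ((B ^+ n) x0) ^+ 2 <= MB ^+ 2 * nrm x0 ^+ 2.
    by rewrite -exprMn ler_pXn2r ?nnegrE ?nrm_ge0 ?mulr_ge0 ?nrm_ge0 ?(ltW MB0).
  rewrite ler_pdivlMr// exprVn ler_pdivrMl// -(ler_pM2r nx0).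
  apply: le_trans (Td n x0) (le_trans (Tup n x0) _).
  rewrite -!mulrA; apply: ler_wpM2l; first exact: exprn_ge0.
  by apply: ler_wpM2l; rewrite // mulrA -expr2.
have c_le1 : c <= 1.
  apply: (@exprn_bounded_le1 _ _ (K * MA ^+ 2 / d)) => n.
  rewrite ler_pdivlMr// -(ler_pM2r nx0).
  set b := nrm ((B ^+ n) x0).
  have b0 : 0 <= b by exact: nrm_ge0.
  have h1 : c ^+ n * b <= MA * nrm x0.
    have : c ^+ n * b ^+ 2 <= MA * b * nrm x0.
      rewrite -rip_sqr -(rip_expr AB) (le_trans (rip_le _ _))//.
      by rewrite ler_wpM2r ?nrm_ge0.
    move: b0; rewrite le_eqVlt => /predU1P[<- _|b0].
      by rewrite mulr0 mulr_ge0 ?nrm_ge0 ?(ltW MA0).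
    by rewrite expr2 mulrA [leRHS]mulrAC ler_pM2r.
  have h2 : (c ^+ n * b) ^+ 2 <= (MA * nrm x0) ^+ 2.
    by rewrite ler_pXn2r ?nnegrE ?mulr_ge0 ?nrm_ge0 ?exprn_ge0 ?(ltW MA0).
  have h3 := le_trans (Td n x0) (Tup n x0).
  have h4 := ler_wpM2l (exprn_ge0 n c0) h3.
  have h5 := ler_wpM2l K0 h2.
  move: h4 h5; rewrite !exprMn -/b; lra.
have c1 : c = 1 by apply/eqP; rewrite eq_le c_le1 c_ge1.
have {}AB v x : rip (A v) x = rip v (B x) by rewrite AB c1 mul1r.
have ABn n v x : rip ((A ^+ n) v) x = rip v ((B ^+ n) x).
  have AB1 v' x' : rip (A v') x' = 1 * rip v' (B x') by rewrite mul1r.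
  by rewrite (rip_expr AB1) expr1n mul1r.
have Ts n x y : rip (T n x) y = rip x (T n y).
  rewrite -[T n x]/((A ^+ n) (P ((B ^+ n) x))) ABn opge0_sym//.
  by rewrite ripC -ABn ripC.
have TC n x : rip (T n x) x <= MA * (K * MB) * nrm x ^+ 2.
  by rewrite (le_trans (rip_le _ _))// expr2 [leRHS]mulrA ler_wpM2r ?nrm_ge0.
have TC0 n x : 0 <= rip (T n x) x <= MA * (K * MB) * nrm x ^+ 2.
  by rewrite TC andbT (le_trans _ (Td n x))// mulr_ge0 ?exprn_ge0 ?nrm_ge0 ?(ltW d0).
have [Q TQ] := monotone_strong_limit Tb Ts TC0 Tnd.
(* The limit Q is invariant: A (T n) B = T n.+1. *)
have rTQ x y : rip (T n x) y @[n --> \oo] --> rip (Q x) y by exact: cvg_rip.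
have QdC x : d * nrm x ^+ 2 <= rip (Q x) x <= MA * (K * MB) * nrm x ^+ 2.
  apply/andP; split.
    by apply: (cvgr_to_ge (rTQ x x)); near=> n; exact: Td.
  by apply: (cvgr_to_le (rTQ x x)); near=> n; exact: TC.
have QB x : rip (Q (B x)) (B x) = rip (Q x) x.
  have h : rip (T n.+1 x) x @[n --> \oo] --> rip (Q (B x)) (B x).
    have -> : (fun n => rip (T n.+1 x) x) = (fun n => rip (T n (B x)) (B x)).
      apply/funext => n; rewrite -AB; congr rip.
      by rewrite /T exprS exprSr -!mulrA.
    exact: rTQ.
  have h' : rip (T n.+1 x) x @[n --> \oo] --> rip (Q x) x.
    by rewrite (cvg_shiftS (fun n => rip (T n x) x)); exact: rTQ.
  by move: h' => /(cvg_unique (@norm_hausdorff _ R) h); apply.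
have [S [Sinv [S0 [SSinv SinvS] SB]]] :=
  invariant_form_isometry d0 (sym_limit Ts TQ) QdC QB.
have Ssym := opge0_sym S0.
have SK z : S (Sinv z) = z by rewrite -[LHS]/((S * Sinv) z) SSinv.
have Sinvsym x y : rip (Sinv x) y = rip x (Sinv y).
  by rewrite -{1}(SK y) -Ssym SK.
pose V := S * B * Sinv; pose Vadj := Sinv * A * S.
have VV x : `|V x| = `|x|.
  rewrite !nrmE -[V x]/(S (B (Sinv x))) SB.
  by rewrite SK.
(* With V = S B S^-1 one has V^* = S^-1 A S, so P1 = S^-1 and P2 = S. *)
exists Sinv, S, S, Sinv, V, Vadj, V; split=> //.
- split; last by split.
  apply: rip_opge0 => // x; rewrite -{2}(SK x) -Ssym.
  exact: opge0_rip_ge0.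
- split=> //; apply: rip_adjoint => x y.
  rewrite -[V x]/(S (B (Sinv x))) Ssym ripC -AB -[Vadj y]/(Sinv (A (S y))).
  by rewrite ripC Sinvsym.
- rewrite /Vadj /V !mulrA SinvS SSinv !mul1r -!mulrA SSinv SinvS !mulr1.
  by [].
Unshelve. all: by end_near. Qed.
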